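(* Let $\mathbf{C}\in\mathbb{S}^d_+$ and $\mathcal{X}\subseteq\{\mathbf{x}\in[0,1]^d:\mathbf{1}^\top\mathbf{x}=s\}$. For every $\mathbf{x}\in\mathcal{X}$, $\gamma_0\in\mathbb{R}_{++}$ and $\boldsymbol{\Upsilon}\in\mathbb{R}^d_{++}$, $$\bar f_{\text{linx-d}}(\mathbf{x},\gamma_0\mathbf{1},\mathbf{1})=\bar f_{\text{linx-o}}(\mathbf{x},\gamma_0),\qquad \bar f_{\text{linx-d}}(\mathbf{x},\mathbf{1},\boldsymbol{\Upsilon}^{-2})=\bar f_{\text{linx-g}}(\mathbf{x},\boldsymbol{\Upsilon}).$$ Consequently, $$\mathrm{Opt}_{\text{linx-d}}\ \ge\ \mathrm{Opt}_{\text{linx-g}}\ \ge\ \mathrm{Opt}_{\text{linx-o}}\ \ge\ \mathrm{Opt}_{\text{linx}} .$$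
   Context: $\mathbb{S}^d_+$ is the cone of real symmetric positive semidefinite $d\times d$ matrices with $s\le\operatorname{rank}(\mathbf{C})$; $\mathcal{X}=\{\mathbf{x}\in[0,1]^d:\mathbf{1}^\top\mathbf{x}=s,\ \mathbf{A}\mathbf{x}\le\mathbf{b}\}$ for given $\mathbf{A},\mathbf{b}$. $\mathrm{Diag}(\mathbf{x})$ is the diagonal matrix with diagonal $\mathbf{x}$, $\mathbf{1}$ the all-ones vector, and $\boldsymbol{\Upsilon}^{-2}$ is taken componentwise. $-\log\det$ of a singular positive semidefinite matrix is $+\infty$, and min/max are understood as inf/sup. Define $$\bar f_{\text{linx-o}}(\mathbf{x},\gamma_0)=-\tfrac12\log\det(\gamma_0\mathbf{C}\mathrm{Diag}(\mathbf{x})\mathbf{C}+\mathbf{I}_d-\mathrm{Diag}(\mathbf{x}))+\tfrac12 s\log\gamma_0,$$ $$\bar f_{\text{linx-g}}(\mathbf{x},\boldsymbol{\gamma})=-\tfrac12\log\det(\mathrm{Diag}(\boldsymbol{\gamma})\mathbf{C}\mathrm{Diag}(\mathbf{x})\mathbf{C}\mathrm{Diag}(\boldsymbol{\gamma})+\mathbf{I}_d-\mathrm{Diag}(\mathbf{x}))+\sum_i x_i\log\gamma_i,$$ $$\bar f_{\text{linx-d}}(\mathbf{x},\boldsymbol{\gamma},\boldsymbol{\mu})=-\tfrac12\log\det(\mathbf{C}\mathrm{Diag}(\boldsymbol{\gamma})\mathrm{Diag}(\mathbf{x})\mathbf{C}+\mathrm{Diag}(\boldsymbol{\mu})(\mathbf{I}_d-\mathrm{Diag}(\mathbf{x})))+\tfrac12\sum_i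 x_i\log\gamma_i+\tfrac12\sum_i(1-x_i)\log\mu_i,$$ and $$\mathrm{Opt}_{\text{linx}}=\min_{\mathbf{x}\in\mathcal{X}}\{-\tfrac12\log\det(\mathbf{C}\mathrm{Diag}(\mathbf{x})\mathbf{C}+\mathbf{I}_d-\mathrm{Diag}(\mathbf{x}))\},\quad \mathrm{Opt}_{\text{linx-o}}=\min_{\mathbf{x}\in\mathcal{X}}\max_{\gamma_0>0}\bar f_{\text{linx-o}}(\mathbf{x},\gamma_0),$$ $$\mathrm{Opt}_{\text{linx-g}}=\min_{\mathbf{x}\in\mathcal{X}}\max_{\boldsymbol{\gamma}\in\mathbb{R}^d_{++}}\bar f_{\text{linx-g}}(\mathbf{x},\boldsymbol{\gamma}),\quad \mathrm{Opt}_{\text{linx-d}}=\min_{\mathbf{x}\in\mathcal{X}}\max_{\boldsymbol{\gamma},\boldsymbol{\mu}\in\mathbb{R}^d_{++}}\bar f_{\text{linx-d}}(\mathbf{x},\boldsymbol{\gamma},\boldsymbol{\mu}).$$ *)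

(* Defs.v *)
From HB Require Import structures.
From mathcomp Require Import all_boot all_order all_algebra.
From mathcomp Require Import all_classical all_reals all_analysis.
Set Implicit Arguments.
Unset Strict Implicit.
Unset Printing Implicit Defensive.
Import Order.TTheory GRing.Theory Num.Theory.

Local Open Scope classical_set_scope.
Local Open Scope ring_scope.

(* Vectors of R^d are row vectors, so that Diag(x) is [diag_mx x]. *)

Definition psdmx (R : realType) (d : nat) (C : 'M[R]_d) : Prop :=
  C^T = C /\ forall v : 'rV[R]_d, 0 <= (v *m C *m v^T) 0 0.

Definition hypersimplex (R : realType) (d s : nat) : set 'rV[R]_d :=
  [set x | (forall i, 0 <= x 0 i <= 1) /\ \sum_i x 0 i = s%:R].

Definition polyhedral_feasible (R : realType) (d s m : nat)
    (A : 'M[R]_(m, d)) (b : 'rV[R]_m) : set 'rV[R]_d :=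
  [set x | hypersimplex s x /\ forall k, (A *m x^T) k 0 <= b 0 k].

Definition posvec (R : realType) (d : nat) : set 'rV[R]_d :=
  [set g | forall i, 0 < g 0 i].

(* [lne] sends every nonpositive number to -oo, so a singular matrix has
   log-determinant -oo.  The matrices below are positive semidefinite for x in
   the unit cube and positive scalings, so no negative determinant arises. *)
Definition logdet (R : realType) (d : nat) (M : 'M[R]_d) : \bar R :=
  lne (\det M)%:E.

Section linx.
Variables (R : realType) (d : nat) (C : 'M[R]_d).

Definition f_linx (x : 'rV[R]_d) : \bar R :=
  (- ((2^-1)%:E * logdet (C *m diag_mx x *m C + 1%:M - diag_mx x)%R))%E.

Definition f_linx_o (s : nat) (x : 'rV[R]_d) (gamma0 : R) : \bar R :=
  (- ((2^-1)%:E *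
      logdet (gamma0 *: (C *m diag_mx x *m C) + 1%:M - diag_mx x)%R)
   + (2^-1 * s%:R * ln gamma0)%:E)%E.

Definition f_linx_g (x gamma : 'rV[R]_d) : \bar R :=
  (- ((2^-1)%:E *
      logdet (diag_mx gamma *m C *m diag_mx x *m C *m diag_mx gamma
              + 1%:M - diag_mx x)%R)
   + (\sum_i x 0 i * ln (gamma 0 i))%:E)%E.

Definition f_linx_d (x gamma mu : 'rV[R]_d) : \bar R :=
  (- ((2^-1)%:E *
      logdet (C *m diag_mx gamma *m diag_mx x *m C
              + diag_mx mu *m (1%:M - diag_mx x))%R)
   + (2^-1 * \sum_i x 0 i * ln (gamma 0 i))%:E
   + (2^-1 * \sum_i (1 - x 0 i) * ln (mu 0 i))%:E)%E.

Definition Opt_linx (X : set 'rV[R]_d) : \bar R :=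
  ereal_inf [set f_linx x | x in X].

Definition Opt_linx_o (s : nat) (X : set 'rV[R]_d) : \bar R :=
  ereal_inf [set ereal_sup [set f_linx_o s x gamma0
                           | gamma0 in [set r : R | 0 < r]]
            | x in X].

Definition Opt_linx_g (X : set 'rV[R]_d) : \bar R :=
  ereal_inf [set ereal_sup [set f_linx_g x gamma | gamma in @posvec R d]
            | x in X].

Definition Opt_linx_d (X : set 'rV[R]_d) : \bar R :=
  ereal_inf [set ereal_sup [set f_linx_d x gamma mu
                           | gamma in @posvec R d & mu in @posvec R d]
            | x in X].

End linx.

Lemma polyhedral_feasible_sub (R : realType) (d s m : nat)
    (A : 'M[R]_(m, d)) (b : 'rV[R]_m) :
  polyhedral_feasible s A b `<=` @hypersimplex R d s.
Proof. by move=> x []. Qed.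

(* Main.v *)
Require Import Defs.
From HB Require Import structures.
From mathcomp Require Import all_boot all_order all_algebra.
From mathcomp Require Import all_classical all_reals all_analysis.
From mathcomp Require Import ring.
Import Order.TTheory GRing.Theory Num.Theory.
Local Open Scope classical_set_scope.
Local Open Scope ring_scope.

(** In the order unscaled, [o], [g], [d], each objective is the next one with
    its scaling parameters restricted to a subfamily.  So the inner suprema
    increase along this chain at every feasible point, and hence so do their
    infima ([ereal_inf_image_le]).

    The restrictions are pointwise identities.  With constant [gamma] and
    [mu = 1], the doubly scaled matrix is the one scaled by a single number
    ([f_linx_d_const]).  With [gamma = 1] and [mu] the componentwise inverse
    square of a vector [g], it becomes the matrix of [f_linx_g] after the
    congruence by [diag_mx g]; that multiplies the determinant by the square
    of the product of the entries of [g] ([logdet_congr]), which the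
    logarithmic terms compensate ([f_linx_d_inv_sqr]).
    The constant vector [Num.sqrt c] turns [f_linx_g] into [f_linx_o] at [c]
    ([f_linx_g_sqrt]), and [c = 1] gives the unscaled objective
    ([f_linx_o1]).  Since the entries of x sum to s, the logarithmic term of a
    constant scaling by c is a multiple of s * ln c, as in [f_linx_o].

    All identities hold in the extended reals: the congruence multiplies the
    determinant by a positive number, so both sides are +oo at the same x. *)

Lemma ln_prod (R : realType) (I : finType) (F : I -> R) :
  (forall i, 0 < F i) -> ln (\prod_i F i) = \sum_i ln (F i).
Proof.
move=> F0; suff [] : 0 < \prod_i F i /\ ln (\prod_i F i) = \sum_i ln (F i) by [].
elim/big_ind2: _ => [|p a q b [p0 <-] [q0 <-]|i _]; last by split.
  by rewrite ln1.
by rewrite mulr_gt0 // lnM.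
Qed.

(** For r <= 0 both sides are -oo, because a * r <= 0 too; this is what lets
    singular matrices follow the same identities as invertible ones. *)
Lemma lne_scale (R : realType) (a r : R) :
  0 < a -> lne (a * r)%:E = (lne r%:E + (ln a)%:E)%E.
Proof.
move=> a0; have [r0|r0] := leP r 0.
  by rewrite !le0_lneNy // lee_fin pmulr_rle0.
by rewrite !lne_EFin ?mulr_gt0 // lnM // -EFinD addrC.
Qed.

(** The determinant of the congruence is the square of the product of the
    entries of g; positivity of g keeps the sign of the determinant. *)
Lemma logdet_congr (R : realType) (d : nat) (g : 'rV[R]_d) (M : 'M[R]_d) :
  posvec g ->
  logdet (diag_mx g *m M *m diag_mx g)
    = (logdet M + (2 * \sum_i ln (g 0 i))%:E)%E.
Proof.
move=> g0; have p0 : 0 < \prod_i g 0 i by apply: prodr_gt0 => i _; exact: g0.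
rewrite /logdet !det_mulmx det_diag mulrAC lne_scale ?mulr_gt0 //.
  rewrite lnM // ln_prod ?mulr_natl ?mulr2n //; exact: g0.
Qed.

Lemma posvec_const (R : realType) (d : nat) (c : R) :
  0 < c -> posvec (const_mx c : 'rV[R]_d).
Proof. by move=> c0 i; rewrite mxE. Qed.

Lemma posvec_inv_sqr (R : realType) (d : nat) (g : 'rV[R]_d) :
  posvec g -> posvec (\row_i g 0 i ^- 2).
Proof. by move=> g0 i; rewrite mxE invr_gt0 exprn_gt0. Qed.

Lemma sum_hypersimplex_mul (R : realType) (d s : nat) (x : 'rV[R]_d) (a : R) :
  hypersimplex s x -> \sum_i x 0 i * a = s%:R * a.
Proof. by case=> _ <-; rewrite mulr_suml. Qed.

Section specializations.
Context {R : realType} {d : nat} (C : 'M[R]_d).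

Lemma f_linx_d_const (s : nat) (x : 'rV[R]_d) (c : R) :
  hypersimplex s x ->
  f_linx_d C x (const_mx c) (const_mx 1) = f_linx_o C s x c.
Proof.
move=> hx; rewrite /f_linx_d /f_linx_o.
under eq_bigr do rewrite mxE.
rewrite (sum_hypersimplex_mul _ _ _ _ _ hx).
under eq_bigr do rewrite mxE ln1 mulr0.
rewrite big1 // mulr0 adde0 mulrA !diag_const_mx mul1mx addrA.
by rewrite mul_mx_scalar -!scalemxAl.
Qed.

(** Multiplying by [diag_mx g] on both sides cancels the inverse squares in
    front of 1 - Diag(x) and puts [diag_mx g] around C Diag(x) C.  The term
    - sum ln g_i lost through the log-determinant and the term
    - sum (1 - x_i) ln g_i coming from [mu] differ by sum x_i ln g_i. *)
Lemma f_linx_d_inv_sqr (x g : 'rV[R]_d) :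
  posvec g ->
  f_linx_d C x (const_mx 1) (\row_i g 0 i ^- 2) = f_linx_g C x g.
Proof.
move=> g0; rewrite /f_linx_d /f_linx_g.
set M := (X in logdet X); set N := (X in _ = (- (_ * logdet X) + _)%E).
have -> : N = diag_mx g *m M *m diag_mx g.
  rewrite /N /M diag_const_mx mulmx1 mulmxDr mulmxDl !mulmxA -addrA.
  congr (_ + _); apply/matrixP => i j.
  (* The second summand is a product of diagonal matrices, whose entries
     (1 - x_i) * g_i ^+ 2 / g_i ^+ 2 simplify. *)
  rewrite mulmx_diag -mulmxA -diag_const_mx -raddfB mulmx_diag /=.
  rewrite mulmx_diag !mxE -mulrnAr.
  case: eqVneq => [_|_]; rewrite ?mulr1n ?mulr0n ?mulr0 //.
  by field; rewrite gt_eqF.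
rewrite logdet_congr //.
under eq_bigr do rewrite mxE ln1 mulr0.
rewrite big1 // mulr0 adde0.
(* Each summand uses (1 - x) * ln (g ^- 2) / 2 = - ln g + x * ln g. *)
have E : 2^-1 * (\sum_i (1 - x 0 i) * ln ((\row_i g 0 i ^- 2) 0 i))
    = - \sum_i ln (g 0 i) + \sum_i x 0 i * ln (g 0 i).
  rewrite mulr_sumr -sumrN -big_split /=; apply: eq_bigr => i _.
  rewrite mxE lnV ?posrE ?exprn_gt0 // lnXn //.
  by field.
rewrite E.
case: (logdet M) => [l||].
- by rewrite -!EFinD; congr EFin; field.
- by rewrite gt0_muley ?lte_fin ?invr_gt0 // !addNye.
- by rewrite addNye gt0_muleNy ?lte_fin ?invr_gt0 //.
Qed.

Lemma f_linx_g_sqrt (s : nat) (x : 'rV[R]_d) (c : R) :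
  0 < c -> hypersimplex s x ->
  f_linx_g C x (const_mx (Num.sqrt c)) = f_linx_o C s x c.
Proof.
move=> c0 hx; rewrite /f_linx_g /f_linx_o.
under eq_bigr do rewrite mxE.
rewrite (sum_hypersimplex_mul _ _ _ _ _ hx) diag_const_mx.
have -> : ln (Num.sqrt c) = 2^-1 * ln c.
  rewrite -[in RHS](sqr_sqrtr (ltW c0)) lnXn ?sqrtr_gt0 //.
  by field.
rewrite mulrCA mulrA mul_mx_scalar !mul_scalar_mx -!scalemxAl scalerA.
by rewrite -expr2 sqr_sqrtr ?ltW.
Qed.

Lemma f_linx_o1 (s : nat) (x : 'rV[R]_d) : f_linx_o C s x 1 = f_linx C x.
Proof. by rewrite /f_linx_o /f_linx ln1 mulr0 adde0 scale1r. Qed.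

End specializations.

Lemma ereal_inf_image_le (R : realType) (T : Type) (X : set T)
    (f g : T -> \bar R) :
  (forall x, X x -> (f x <= g x)%E) ->
  (ereal_inf [set f x | x in X] <= ereal_inf [set g x | x in X])%E.
Proof.
move=> fg; apply: le_ereal_inf_tmp => _ [x Xx <-].
by apply: ge_ereal_inf; exists (f x); [exists x | exact: fg].
Qed.

Theorem mainTheorem9 (R : realType) (d s : nat) (C : 'M[R]_d)
    (X : set 'rV[R]_d)
    (hC : psdmx C) (hs : (s <= \rank C)%N)
    (hX : X `<=` @hypersimplex R d s) :
  (forall (x : 'rV[R]_d) (gamma0 : R) (Upsilon : 'rV[R]_d),
     X x -> 0 < gamma0 -> posvec Upsilon ->
     f_linx_d C x (const_mx gamma0) (const_mx 1) = f_linx_o C s x gamma0 /\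
     f_linx_d C x (const_mx 1) (\row_i Upsilon 0 i ^- 2)
       = f_linx_g C x Upsilon) /\
  [/\ (Opt_linx_g C X <= Opt_linx_d C X)%E,
      (Opt_linx_o C s X <= Opt_linx_g C X)%E &
      (Opt_linx C X <= Opt_linx_o C s X)%E].
Proof.
split.
  move=> x c g /hX hx c0 g0.
  by split; [exact: f_linx_d_const | exact: f_linx_d_inv_sqr].
split; apply: ereal_inf_image_le => x /hX hx.
- apply: ereal_sup_le => _ [g g0 <-].
  exists (const_mx 1); first exact: posvec_const.
  exists (\row_i g 0 i ^- 2); first exact: posvec_inv_sqr.
  exact: f_linx_d_inv_sqr.
- apply: ereal_sup_le => _ [c c0 <-].
  exists (const_mx (Num.sqrt c)); last exact: f_linx_g_sqrt.
  by apply: posvec_const; rewrite sqrtr_gt0.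
- by apply: ereal_sup_ubound; exists 1; [exact: ltr01 | exact: f_linx_o1].
Qed.
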